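(* Let $G$ be a complex simply connected almost Abelian Lie group with Lie algebra $\mathfrak{a}(\aleph)$, realized as the matrix group described in the context. Then the exponential map $\exp:\mathfrak{a}(\aleph)\to G$ is given, for all $(v,t)\in\mathbb{C}^d\oplus\mathbb{C}$, by $$\exp\begin{pmatrix} 0&0&0\\ v & tJ(\aleph) & 0\\ t & 0 & 0\end{pmatrix} = \begin{pmatrix} 1 & 0 & 0\\ \frac{e^{tJ(\aleph)}-\mathbb{1}}{tJ(\aleph)}\,v & e^{tJ(\aleph)} & 0\\ t & 0 & 1\end{pmatrix}\in G.$$
   Context: A finitely-supported multiplicity function is a function $\aleph:\mathbb{C}\times\mathbb{N}\to\{0,1,2,\dots\}$ (with $\mathbb{N}=\{1,2,\dots\}$) that is nonzero at only finitely many pairs. Its Jordan matrix $J(\aleph)$ is the $d\times d$ block-diagonal matrix containing, for each $(\lambda,n)$, exactly $\aleph(\lambda,n)$ copies of the $n\times n$ Jordan block with eigenvalue $\lambda$ (ones on the superdiagonal). The Lie algebra $\mathfrak{a}(\aleph)$ is $\mathbb{C}^d\oplus\mathbb{C}$ with bracket $[(v,t),(u,s)] = (tJ(\aleph)u - sJ(\aleph)v,0)$; it is almost Abelian (non-Abelian with a codimension 1 Abelian subalgebra), so $J(\aleph)\neq 0$. It is realized faithfully by the $(d+2)\times(d+2)$ matrices $$\begin{pmatrix} 0&0&0\\ v & tJ(\aleph) & 0\\ t & 0 & 0\end{pmatrix},\quad (v,t)\in\mathbb{C}^d\oplus\mathbb{C},$$ and the simply connected group $G$ is realized as the group of matrices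 $$\begin{pmatrix} 1&0&0\\ v & e^{tJ(\aleph)} & 0\\ t & 0 & 1\end{pmatrix},\quad (v,t)\in\mathbb{C}^d\oplus\mathbb{C}.$$ The expression $\frac{e^{tJ}-\mathbb{1}}{tJ}$ denotes the convergent series $\sum_{n=1}^\infty \frac{1}{n!}(tJ)^{n-1}$ (so no invertibility of $tJ$ is required). *)

(* Defs.v *)
From HB Require Import structures.
From mathcomp Require Import all_boot all_order all_algebra finmap.
From mathcomp Require Import boolp classical_sets reals topology normedtype.
From mathcomp Require Import sequences.
From mathcomp Require Export complex.

Set Implicit Arguments.
Unset Strict Implicit.
Unset Printing Implicit Defensive.

Import GRing.Theory Num.Theory numFieldNormedType.Exports.

Local Open Scope classical_set_scope.
Local Open Scope ring_scope.

(* The definitions are over an arbitrary numFieldType K (whose canonical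
   topology is that of its norm) and are meant to be used at K := R[i], the
   complex numbers, with R a realType.  Matrices over K carry the topology of
   entrywise convergence. *)

Section MatrixSeries.
Context {K : numFieldType} {n : nat}.
Implicit Type A : 'M[K]_n.

Definition expmx_series A : nat -> 'M[K]_n :=
  series (fun k => (k`!)%:R^-1 *: A ^+ k).

Definition expmx A : 'M[K]_n := limn (expmx_series A).

(* Partial sums of the entire function (exp z - 1) / z at A, which need not be
   invertible. *)
Definition expmx_quot_series A : nat -> 'M[K]_n :=
  fun N => \sum_(1 <= k < N.+1) (k`!)%:R^-1 *: A ^+ k.-1.

Definition expmx_quot A : 'M[K]_n := limn (expmx_quot_series A).

(* limn is a total operator: these two predicates say that the limits above
   exist. *)
Definition expmx_cvg A : Prop := cvgn (expmx_series A).
Definition expmx_quot_cvg A : Prop := cvgn (expmx_quot_series A).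

End MatrixSeries.

Section Jordan.
Context {K : numFieldType}.

Definition multiplicity : Type :=
  {fsfun (K * {n : nat | (0 < n)%N}) -> nat with 0%N}.

Definition jordan_block (lambda : K) (n : nat) : 'M[K]_n :=
  \matrix_(i < n, j < n) (lambda *+ (i == j) + (i.+1 == j :> nat)%:R).

Context (aleph : multiplicity).

(* The blocks are listed in the order in which finsupp enumerates the support;
   a pair p occurs aleph p times in the list. *)
Definition jordan_blocks : seq (K * {n : nat | (0 < n)%N}) :=
  flatten [seq nseq (aleph p) p | p <- enum_fset (finsupp aleph)].

Definition jordan_eigenvalue (i : 'I_(size jordan_blocks)) : K :=
  (tnth (in_tuple jordan_blocks) i).1.

Definition jordan_size (i : 'I_(size jordan_blocks)) : nat :=
  val (tnth (in_tuple jordan_blocks) i).2.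

Definition jordan_dim : nat := \sum_(i < size jordan_blocks) jordan_size i.

Definition jordan_mx : 'M[K]_jordan_dim :=
  \mxdiag_(i < size jordan_blocks)
    jordan_block (jordan_eigenvalue i) (jordan_size i).

End Jordan.

Arguments multiplicity : clear implicits.

Section AlmostAbelian.
Context {K : numFieldType}.

Definition almost_abelian (V : vectType K) (bracket : V -> V -> V) : Prop :=
  (exists x y : V, bracket x y <> 0) /\
  (exists U : {vspace V},
    [/\ (\dim U).+1 = \dim {:V},
        {in U &, forall x y, bracket x y \in U} &
        {in U &, forall x y, bracket x y = 0}]).

Context {d : nat} (J : 'M[K]_d).

Definition aa_bracket (x y : 'cV[K]_d * K^o) : 'cV[K]_d * K^o :=
  let: (v, t) := x in let: (u, s) := y in
  (t *: (J *m u) - s *: (J *m v), 0).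

(* / a 0 0 \
   | v M 0 |
   \ t 0 a /  with row and column blocks of sizes 1, d, 1; a is 0 for the Lie
   algebra and 1 for the group. *)
Definition aa_block_mx (a : K) (v : 'cV[K]_d) (M : 'M[K]_d) (t : K) :
    'M[K]_(1 + (d + 1)) :=
  block_mx a%:M               0
           (col_mx v t%:M)    (block_mx M 0
                                        0 a%:M).

Definition aa_algebra_mx (v : 'cV[K]_d) (t : K) : 'M[K]_(1 + (d + 1)) :=
  aa_block_mx 0 v (t *: J) t.

Definition aa_group : set 'M[K]_(1 + (d + 1)) :=
  [set g | exists (v : 'cV[K]_d) (t : K), g = aa_block_mx 1 v (expmx (t *: J)) t].

End AlmostAbelian.

(* Main.v *)
(* Write (a, v, A, s) for the block matrix with scalar corners a, diagonal
   block A and first column (a, v, s), and let M = (0, v, A, t) with A = tJ.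
   Then M^(k+1) = (0, A^k v, A^(k+1), 0) for k >= 1, so from the second one on
   the partial sums of exp M are (1, q v, e, t) with e and q partial sums of
   exp A and (exp A - 1)/A.  These converge entrywise: the entries of A^k are
   at most c^k, where c is the sum of the norms of the entries of A. *)

Require Import Defs.
From mathcomp Require Import all_boot all_order all_algebra finmap.
From mathcomp Require Import boolp classical_sets reals topology normedtype.
From mathcomp Require Import sequences.

Set Implicit Arguments.
Unset Strict Implicit.
Unset Printing Implicit Defensive.

Import Order.TTheory GRing.Theory Num.Theory numFieldNormedType.Exports.

Local Open Scope classical_set_scope.
Local Open Scope ring_scope.

(** * Complex series dominated by an exponential series *)

Section ComplexSeries.
Variable R : realType.
Local Notation C := (R[i] : numFieldType).
Local Open Scope complex_scope.

(** The embedding is an isometry, so a radius in [C] only has to be transported to [R]. *)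
Lemma real_complex_continuous : continuous (fun x : R => x%:C : C).
Proof.
move=> x; apply/cvgrPdist_lt => e e0.
(* The radius [e] is a complex number; positivity forces it to be real. *)
have eE : (complex.Re e)%:C = e by rewrite RRe_real// realE ltW.
have e'0 : 0 < complex.Re e by rewrite -ltcR eE.
near=> y.
rewrite -rmorphB normc_def/= expr0n/= addr0 sqrtr_sqr -eE ltcR.
near: y; exact: cvgr_dist_lt.
Unshelve. all: by end_near. Qed.

Lemma cvg_complex (u : nat -> C) (a b : R) :
  (fun k => complex.Re (u k)) @ \oo --> a ->
  (fun k => complex.Im (u k)) @ \oo --> b -> u @ \oo --> (a +i* b : C).
Proof.
move=> ua ub; rewrite [_ +i* _]complexE/=.
rewrite (_ : u = fun k => (complex.Re (u k))%:C + 'i * (complex.Im (u k))%:C);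
  last by apply/funext => k; rewrite -complexE.
have cvgC (f : nat -> R) (l : R) : f @ \oo --> l ->
    (fun k => (f k)%:C : C) @ \oo --> (l%:C : C).
  exact: (continuous_cvg _ (@real_complex_continuous l)).
exact: (@cvgD _ C^o _ _ _ _ _ _ _ (cvgC _ _ ua)
         (cvgMl_tmp (a := 'i : C) (cvgC _ _ ub))).
Qed.

Lemma normc_ge_Im (x : R[i]) : `|complex.Im x|%:C <= `|x|.
Proof.
by rewrite normc_def lecR -sqrtr_sqr ler_wsqrtr// lerDr sqr_ge0.
Qed.

Lemma is_cvg_exp_majorant (u : nat -> R) (r : R) :
  (forall k, `|u k| <= r ^+ k / k`!%:R) -> cvgn (series u).
Proof.
move=> ur; apply: normed_cvg; apply: (@series_le_cvg _ _ (exp_coeff r)) => //=.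
- by move=> k; exact: le_trans (ur k).
- exact: is_cvg_series_exp_coeff.
Qed.

(** Real and imaginary parts are bounded by the modulus, so both real series converge by comparison
    with the real exponential series; completeness is invoked in [R] only. *)
Lemma is_cvg_complex_exp_majorant (u : nat -> C) (c : C) : 0 <= c ->
  (forall k, `|u k| <= c ^+ k / k`!%:R) -> cvgn (series u).
Proof.
move=> c0 uc.
have cE : (complex.Re c)%:C = c by rewrite RRe_real// realE c0.
have {}uc k : `|u k| <= (complex.Re c ^+ k / k`!%:R)%:C.
  by rewrite rmorphM fmorphV rmorph_nat rmorphXn/= [X in X ^+ _]cE.
have uRe : cvgn (series (fun k => complex.Re (u k))).
  apply: (@is_cvg_exp_majorant _ (complex.Re c)) => k.
  by rewrite -lecR; apply: le_trans (uc k); exact: normc_ge_Re.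
have uIm : cvgn (series (fun k => complex.Im (u k))).
  apply: (@is_cvg_exp_majorant _ (complex.Re c)) => k.
  by rewrite -lecR; apply: le_trans (uc k); exact: normc_ge_Im.
apply/cvg_ex; exists (limn (series (fun k => complex.Re (u k))) +i*
                      limn (series (fun k => complex.Im (u k)))).
apply: cvg_complex.
(* Real parts commute with partial sums. *)
- rewrite (_ : (fun _ => _) = series (fun k => complex.Re (u k)))//.
  apply/funext => n; rewrite /series/=.
  by elim/big_rec2 : _ => // k x y _ <-; case: (u k) y => ? ? [].
- rewrite (_ : (fun _ => _) = series (fun k => complex.Im (u k)))//.
  apply/funext => n; rewrite /series/=.
  by elim/big_rec2 : _ => // k x y _ <-; case: (u k) y => ? ? [].
Qed.

End ComplexSeries.

(** * Entrywise convergence of matrices *)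

Section MatrixConvergence.
Context {K : numFieldType}.

Lemma cvg_mxP {T} {F : set_system T} {FF : Filter F} m n
    (f : T -> 'M[K]_(m, n)) (M : 'M[K]_(m, n)) :
  f @ F --> M <-> forall i j, (fun x => f x i j) @ F --> M i j.
Proof.
split=> [fM i j|fM].
  exact: (continuous_cvg _ (@coord_continuous K m n i j M) fM).
(* A neighbourhood of [M] contains a product of neighbourhoods [P i j] of its entries; there are
   finitely many, so all of them are eventually entered at once. *)
move=> A [P MP PA].
have FP : \forall x \near F, forall i j, P i j (f x i j).
  apply: filter_forall => i; apply: filter_forall => j.
  exact: (fM i j _ (MP i j)).
by apply: filterS FP => x Px; apply: PA.
Qed.

Lemma cvg_mx_lim {T} {F : set_system T} {FF : ProperFilter F} m n
    (f : T -> 'M[K]_(m, n)) (M : 'M[K]_(m, n)) :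
  f @ F --> M -> lim (f @ F) = M.
Proof.
move=> fM; have /cvg_mxP fl : f @ F --> lim (f @ F) by apply: (cvgP _ fM).
move/cvg_mxP : fM => fM.
by apply/matrixP => i j; apply: cvg_unique (fl i j) (fM i j); exact: norm_hausdorff.
Qed.

Lemma cvg_mulmxr {T} {F : set_system T} {FF : Filter F} m n p
    (f : T -> 'M[K]_(m, n)) (M : 'M[K]_(m, n)) (B : 'M[K]_(n, p)) :
  f @ F --> M -> (fun x => f x *m B) @ F --> M *m B.
Proof.
move=> /cvg_mxP fM; apply/cvg_mxP => i j; rewrite mxE.
under eq_fun do rewrite mxE.
apply: (cvg_big add_continuous) => k _; apply: cvgMr_tmp; exact: fM.
Qed.

Lemma cvg_aa_block_mx {T} {F : set_system T} {FF : Filter F} d a t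
    (f : T -> 'cV[K]_d) (g : T -> 'M[K]_d) v M :
  f @ F --> v -> g @ F --> M ->
  (fun x => aa_block_mx a (f x) (g x) t) @ F --> aa_block_mx a v M t.
Proof.
move=> /cvg_mxP fv /cvg_mxP gM; apply/cvg_mxP => i j.
rewrite /aa_block_mx; under eq_fun do rewrite !mxE.
(* The top row is constant. Below it, only the blocks filled by [f] and [g] vary. *)
rewrite !mxE; case: (split i) => {}i.
  by under eq_fun do rewrite !mxE; rewrite !mxE; exact: cvg_cst.
under eq_fun do rewrite !mxE.
rewrite !mxE; case: (split j) => {}j; under eq_fun do rewrite !mxE; rewrite !mxE;
  case: (split i) => {}i.
- exact: fv.
- exact: cvg_cst.
- under eq_fun do rewrite !mxE; rewrite !mxE; case: (split j) => {}j.
    exact: gM.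
  exact: cvg_cst.
- by under eq_fun do rewrite !mxE; rewrite !mxE; exact: cvg_cst.
Qed.

End MatrixConvergence.

(** * Powers and partial sums of block matrices *)

Section BlockSeries.
Context {K : numFieldType}.

(** Induction on [k]: expanding [A * A ^+ k] along row [i] costs a factor equal to a row sum of
    norms, which is at most the total sum. *)
Lemma norm_mx_expr_le n (A : 'M[K]_n) k i j :
  `|(A ^+ k) i j| <= (\sum_p \sum_q `|A p q|) ^+ k.
Proof.
set c := \sum_p _.
have row_le p : \sum_q `|A p q| <= c.
  by rewrite [leRHS](bigD1 p)//= lerDl sumr_ge0// => q _; rewrite sumr_ge0.
have c0 : 0 <= c by rewrite sumr_ge0// => p _; rewrite sumr_ge0.
elim: k i j => [|k IH] i j.
  (* The bound is 1 here even if [c] is 0, which covers the entries of the identity. *)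
  by rewrite !expr0 mxE; case: eqP => _; rewrite ?normr1 ?normr0.
rewrite exprS mxE (le_trans (ler_norm_sum _ _ _))// exprS.
apply: le_trans (ler_wpM2r (exprn_ge0 k c0) (row_le i)).
rewrite mulr_suml ler_sum// => q _.
by rewrite normrM ler_wpM2l.
Qed.

Lemma aa_block_mx1 d : 1 = aa_block_mx 1 0 1 0 :> 'M[K]_(1 + (d + 1)).
Proof.
have oneE m : 1 = 1%:M :> 'M[K]_m by [].
by rewrite /aa_block_mx raddf0 col_mx0 !oneE -!scalar_mx_block.
Qed.

Lemma aa_block_mxD d (a b s t : K) (v w : 'cV[K]_d) (M N : 'M[K]_d) :
  aa_block_mx a v M s + aa_block_mx b w N t =
  aa_block_mx (a + b) (v + w) (M + N) (s + t).
Proof. by rewrite /aa_block_mx !add_block_mx add_col_mx !addr0 !raddfD. Qed.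

Lemma aa_block_mxZ d (c a t : K) (v : 'cV[K]_d) (M : 'M[K]_d) :
  c *: aa_block_mx a v M t = aa_block_mx (c * a) (c *: v) (c *: M) (c * t).
Proof.
by rewrite /aa_block_mx !scale_block_mx scale_col_mx !scaler0 !scale_scalar_mx.
Qed.

Lemma aa_block_mxM d (a b s t : K) (v w : 'cV[K]_d) (M N : 'M[K]_d) :
  aa_block_mx a v M s * aa_block_mx b w N t =
  aa_block_mx (a * b) (b *: v + M *m w) (M * N) (s * b + a * t).
Proof.
rewrite /aa_block_mx -mulmxE !mulmx_block mul_col_mx mul_block_col add_col_mx.
by rewrite !(mul0mx, mulmx0, addr0, add0r) -!scalar_mxM mul_mx_scalar raddfD.
Qed.

(** The formula starts at exponent 2 because the first power still carries [t]; the zero corners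
    remove it in the next product. *)
Lemma aa_block_mx_expr d (v : 'cV[K]_d) (A : 'M[K]_d) t k :
  aa_block_mx 0 v A t ^+ k.+2 = aa_block_mx 0 (A ^+ k.+1 *m v) (A ^+ k.+2) 0.
Proof.
elim: k => [|k IH].
  by rewrite !expr2 aa_block_mxM !mul0r mulr0 scale0r add0r addr0.
by rewrite exprS IH aa_block_mxM !mul0r mulr0 scale0r !add0r mulmxA mulmxE -!exprS.
Qed.

Lemma expmx_quot_seriesE n (A : 'M[K]_n) :
  expmx_quot_series A = series (fun k => (k.+1`!)%:R^-1 *: A ^+ k).
Proof.
by apply/funext => N; rewrite /expmx_quot_series big_add1.
Qed.

(** The quotient sum begins at degree 1, hence has one term fewer. Two terms are needed at the
    start: degree 0 gives the unit corners, degree 1 gives [t]. *)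
Lemma expmx_series_aa_block d (v : 'cV[K]_d) (A : 'M[K]_d) t N :
  expmx_series (aa_block_mx 0 v A t) N.+2 =
  aa_block_mx 1 (expmx_quot_series A N.+1 *m v) (expmx_series A N.+2) t.
Proof.
rewrite expmx_quot_seriesE /expmx_series.
elim: N => [|N IH].
  rewrite /series/= !big_nat_recr//= !big_geq// !add0r !fact0 !factS invr1 !scale1r.
  by rewrite !expr0 !expr1 aa_block_mx1 aa_block_mxD addr0 !add0r mul1mx.
rewrite (seriesSr _ N.+2) IH aa_block_mx_expr aa_block_mxZ aa_block_mxD.
rewrite [in RHS](seriesSr _ N.+2) [X in _ = aa_block_mx _ (X *m _) _ _]seriesSr.
by rewrite !mulr0 !addr0 mulmxDl scalemxAl.
Qed.

End BlockSeries.

(** * Convergence and value of the complex matrix exponential *)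

Section ComplexExponential.
Variable R : realType.
Local Notation C := (R[i] : numFieldType).

(** Leaving the coefficients general treats the exponential and its quotient series together: each
    entry is dominated by [c ^+ k / k!]. *)
Lemma is_cvg_mx_exp_majorant n (A : 'M[C]_n) (a : nat -> C) :
  (forall k, `|a k| <= k`!%:R^-1) -> cvgn (series (fun k => a k *: A ^+ k)).
Proof.
move=> a_le; set c := \sum_p \sum_q `|A p q|.
have c0 : 0 <= c by rewrite sumr_ge0// => p _; rewrite sumr_ge0.
have cu i j : cvgn (series (fun k => a k * (A ^+ k) i j)).
  apply: (is_cvg_complex_exp_majorant c0) => k.
  by rewrite normrM [leLHS]mulrC ler_pM//; [exact: norm_mx_expr_le | exact: a_le].
apply/cvg_ex; exists (\matrix_(i, j) limn (series (fun k => a k * (A ^+ k) i j))).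
apply/cvg_mxP => i j; rewrite mxE.
rewrite (_ : (fun _ => _) = series (fun k => a k * (A ^+ k) i j)); first exact: cu.
apply/funext => N; rewrite /series/= summxE.
by apply: eq_bigr => k _; rewrite mxE.
Qed.

Lemma expmx_cvg_complex n (A : 'M[C]_n) : expmx_cvg A.
Proof. by apply: is_cvg_mx_exp_majorant => k; rewrite normfV normr_nat. Qed.

Lemma expmx_quot_cvg_complex n (A : 'M[C]_n) : expmx_quot_cvg A.
Proof.
rewrite /expmx_quot_cvg expmx_quot_seriesE.
apply: (is_cvg_mx_exp_majorant (a := fun k => (k.+1)`!%:R^-1)) => k.
by rewrite normfV normr_nat lef_pV2 ?posrE ?ltr0n ?fact_gt0// ler_nat factS leq_pmull.
Qed.

Lemma expmx_aa_block d (v : 'cV[C]_d) (A : 'M[C]_d) (t : C) :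
  expmx (aa_block_mx 0 v A t) = aa_block_mx 1 (expmx_quot A *m v) (expmx A) t.
Proof.
(* Dropping two partial sums leaves the limit unchanged and reaches the range where the block form
   is available. *)
apply: cvg_mx_lim; rewrite -(cvg_shiftn 2)/=.
under eq_fun do rewrite addn2 expmx_series_aa_block.
apply: cvg_aa_block_mx.
- apply: cvg_mulmxr.
  have : expmx_quot_cvg A by exact: expmx_quot_cvg_complex.
  rewrite /expmx_quot_cvg -(cvg_shiftn 1).
  by under eq_fun do rewrite addn1.
- have : expmx_cvg A by exact: expmx_cvg_complex.
  rewrite /expmx_cvg -(cvg_shiftn 2).
  by under eq_fun do rewrite addn2.
Qed.

End ComplexExponential.

Theorem proposition3p4 (R : realType) (aleph : multiplicity R[i]) :
  let J := jordan_mx aleph in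
  almost_abelian (aa_bracket J) ->
  forall (v : 'cV[R[i]]_(jordan_dim aleph)) (t : R[i]),
  [/\ expmx_cvg (aa_algebra_mx J v t),
      expmx_cvg (t *: J),
      expmx_quot_cvg (t *: J),
      expmx (aa_algebra_mx J v t) =
        aa_block_mx 1 (expmx_quot (t *: J) *m v) (expmx (t *: J)) t &
      expmx (aa_algebra_mx J v t) \in aa_group J].
Proof.
move=> J _ v t.
have expE := expmx_aa_block v (t *: J) t.
split; [exact: expmx_cvg_complex | exact: expmx_cvg_complex |
  exact: expmx_quot_cvg_complex | exact: expE |].
(* The first column of the exponential is the witness, with the same [t]. *)
by rewrite inE; exists (expmx_quot (t *: J) *m v), t.
Qed.
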